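(* Let $k\geq 3$ be an integer and let $(n_1,\ldots,n_k)$ be a $k$-tuple of positive integers with $n_1\geq n_2\geq\cdots\geq n_k$. Let $p=\sum_{i=1}^k n_i$. If $n_1\leq \frac{p}{2}$, then every graph $G$ in $\mathcal{G}(n_1,\ldots,n_k)$ having at least $$\|K(n_1,\ldots,n_k)\|-(p-n_1-2)=\frac{4-2p+2n_1+\sum_{i=1}^{k}n_i(p-n_i)}{2}$$ edges is chorded pancyclic.
   Context: All graphs are finite and simple. For positive integers $n_1\ge\cdots\ge n_k$, $\mathcal{G}(n_1,\ldots,n_k)$ denotes the set of all $k$-partite graphs with parts $V_1,\ldots,V_k$ such that $|V_i|=n_i$ for every $i$ (i.e. the vertex set is the disjoint union of the $V_i$, and no two vertices in the same part are adjacent). $K(n_1,\ldots,n_k)$ is the complete $k$-partite graph with these part sizes (any two vertices in different parts are adjacent). $\|G\|$ denotes the number of edges of $G$. A chord of a cycle $C$ in $G$ is an edge of $G$ joining two non-consecutive vertices of $C$; a cycle with $t$ vertices having a chord is a chorded $t$-cycle. A graph of order $p$ is chorded pancyclic if it contains a chorded $t$-cycle for every integer $t$ with $4\leq t\leq p$ (a vacuous condition if $p=3$). *)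

(* Defs.v *)
(* MathComp *)
From mathcomp Require Import all_boot all_order all_algebra.

Set Implicit Arguments.
Unset Strict Implicit.
Unset Printing Implicit Defensive.

Record sgraph := SGraph {
  vertex :> finType;
  adj : rel vertex;
  adj_sym : symmetric adj;
  adj_irrefl : irreflexive adj
}.

Definition edges (G : sgraph) : {set {set G}} :=
  [set [set u.1; u.2] | u : G * G & adj u.1 u.2].

Definition num_edges (G : sgraph) : nat := #|edges G|.

Definition multipartite_class (k : nat) (n : k.-tuple nat) (G : sgraph) : Prop :=
  exists V : 'I_k -> {set G},
    [/\ \bigcup_i V i = [set: G],
        forall i j, i != j -> [disjoint V i & V j],
        forall i, #|V i| = tnth n i
      & forall i x y, x \in V i -> y \in V i -> ~~ adj x y].

Definition complete_adj (k : nat) (n : k.-tuple nat) :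
    rel {i : 'I_k & 'I_(tnth n i)} :=
  fun x y => tag x != tag y.

Fact complete_adj_sym (k : nat) (n : k.-tuple nat) :
  symmetric (@complete_adj k n).
Proof. by move=> x y; rewrite /complete_adj eq_sym. Qed.

Fact complete_adj_irrefl (k : nat) (n : k.-tuple nat) :
  irreflexive (@complete_adj k n).
Proof. by move=> x; rewrite /complete_adj eqxx. Qed.

Definition complete_multipartite (k : nat) (n : k.-tuple nat) : sgraph :=
  SGraph (@complete_adj_sym k n) (@complete_adj_irrefl k n).

(* The bound on the size excludes the closed walks x y x that [ucycle] allows. *)
Definition is_cycle (G : sgraph) (c : seq G) : bool :=
  (2 < size c) && ucycleb (@adj G) c.

Definition is_chord (G : sgraph) (c : seq G) (x y : G) : bool :=
  [&& x \in c, y \in c, adj x y, y != next c x & x != next c y].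

Definition has_chorded_cycle (G : sgraph) (t : nat) : Prop :=
  exists c : seq G,
    [/\ is_cycle c, size c = t & exists x y, is_chord c x y].

Definition chorded_pancyclic (G : sgraph) : Prop :=
  forall t : nat, 4 <= t <= #|G| -> has_chorded_cycle G t.

(* Main.v *)
Require Import Defs.
From mathcomp Require Import all_boot all_order all_algebra.
From mathcomp Require Import zify ring lra.

Set Implicit Arguments.
Unset Strict Implicit.
Unset Printing Implicit Defensive.

(** Why the theorem holds.

Write [p] for the number of vertices, [n_v] for the size of the part of a
vertex [v], [a] for the largest part size, [m_v] for the number of vertices
outside the part of [v] that are not adjacent to [v], and [m] for the number
of missing edges, so that the [m_v] add up to [2 m]. Call a vertex set
admissible if it meets three parts, [2 n_i <= p] for all [i] and
[m <= p - a - 2] (all read inside the set). The hypotheses say that the whole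
vertex set is admissible.

Everything rests on deleting one vertex. An admissible set with at least four
vertices contains a vertex [v] such that the rest is again admissible and
[2 m_v < p - n_v] ([delete_vertex]). The second condition is cheap: of any two
vertices, at least one, say [x], satisfies [2 m_x < p - a], because
[m_x + m_y <= m + 1 < p - a].

Deletion yields an admissible subset of every size [t] from 3 to [p]
([admissible_subset]), so it is enough to find a chorded Hamilton cycle in an
admissible set. A chord comes for free at a vertex of degree at least 3, and
such a vertex exists by counting ([admissible_degree]). A Hamilton cycle comes
by induction from the same deletion, once the deleted vertex can be put back
([insert_vertex]).

For the insertion, let [C] be a Hamilton cycle of the set without [v], suppose
that there is no Hamilton cycle with [v], and let [d = p - n_v - m_v] be the
degree of [v]. The rest misses at most [d - 2] edges and [m_v < d]. The
[d] successors on [C] of the neighbours of [v] form an independent set together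
with [v]. Were they not all in the part of [v], they would be split between
that part and its complement, giving at least [d - 1] missing edges away from
[v], or lie wholly outside, giving [m_v >= d]; both are impossible. So they lie
in the part of [v], and so do the predecessors. As [2 n_v <= p], some edge
[q q'] of [C] avoids the part of [v]. If [q'] is adjacent to some successor
[z], rotating the Hamilton path from [z] to [v] at [q'] gives one from [q] to
[v]; then [q] misses [d] vertices of the part of [v], one of which may be [v].
Otherwise [q'] misses all [d] successors. Either way more than [d - 2] edges
are missing away from [v]. *)

(** * Successors in cyclic sequences *)

Section Seq.
Context {T : eqType}.

Lemma next_consecutive (s1 s2 : seq T) (x y : T) :
  uniq (s1 ++ x :: y :: s2) -> next (s1 ++ x :: y :: s2) x = y.
Proof. by move=> U; rewrite -(next_rot (size s1) U) rot_size_cat /= eqxx. Qed.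

Lemma next_split (x0 : T) (s : seq T) (x : T) :
    uniq s -> x \in s -> x != last x0 s ->
  exists s1 s2, s = s1 ++ x :: next s x :: s2.
Proof.
move=> U xs; move: U; case/splitPr: xs => s1 [|y s2] U.
  by rewrite last_cat /= eqxx.
by exists s1, s2; rewrite next_consecutive.
Qed.

Lemma next_inj (s : seq T) : uniq s -> injective (next s).
Proof. by move=> U; apply: can_inj (prev_next U). Qed.

Lemma rot_to_last (s : seq T) (x : T) : uniq s -> x \in s ->
  exists n s1, rot n s = rcons s1 x.
Proof.
move=> U xs; case/splitPr: xs => s1 s2.
exists (size (rcons s1 x)), (s2 ++ s1).
by rewrite -cat_rcons rot_size_cat rcons_cat.
Qed.

End Seq.

(** * Hamilton cycles and rotations *)

Section Graph.
Context {G : sgraph}.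
Local Notation e := (@adj G).
Implicit Types (A B : {set G}) (c s : seq G) (x y z v w : G).

Definition ham_cycle A c := [/\ uniq c, cycle e c & c =i A].

(** A boolean, so that the absence of a Hamilton cycle can be assumed for a
contradiction without a classical axiom. *)
Definition hamiltonian A : bool :=
  [exists c : #|A|.-tuple G, [&& uniq c, cycle e c & [set x in c] == A]].

Lemma hamiltonianP A : reflect (exists c, ham_cycle A c) (hamiltonian A).
Proof.
apply: (iffP existsP) => [[c /and3P[U C /eqP cA]]|[c [U C cA]]].
  by exists c; split=> // x; rewrite -[in RHS]cA inE.
have sc : size c == #|A| by rewrite -(eq_card cA) (card_uniqP U).
exists (Tuple sc); rewrite /= U C /=; apply/eqP/setP => x.
by rewrite inE cA.
Qed.

(** The classical crossing of two chords: cut the path [x ... b y ... v] between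
[b] and its successor [y]; the edges [b v] and [x y] close it to the cycle
[x ... b v ... y]. *)
Lemma crossing A x s b : uniq (x :: s) -> path e x s -> x :: s =i A ->
  b \in x :: s -> e b (last x s) -> e x (next (x :: s) b) -> hamiltonian A.
Proof.
move=> U P EA bs ebv.
have bl: b != last x (x :: s).
  by apply/negP => /eqP E; move: ebv; rewrite -[last x s]E adj_irrefl.
have [s1 [s2]] := next_split U bs bl; move: (next _ b) => y E exy.
have lE: last x s = last y s2 by rewrite -[LHS]/(last x (x :: s)) E last_cat.
have revE: rev (y :: s2) = last y s2 :: rev (belast y s2).
  by rewrite [y :: s2]lastI rev_rcons.
apply/hamiltonianP; exists (s1 ++ b :: rev (y :: s2)); split.
- apply: etrans U; rewrite E; apply: perm_uniq.
  by rewrite perm_cat2l perm_cons perm_rev.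
- rewrite (cycle_path x) last_cat /= rev_cons last_rcons -rev_cons.
  rewrite -cat_rcons cat_path last_rcons revE /= -lE ebv lE /=.
  rewrite (rev_path e y s2) (eq_path (e' := e)) => [|u w]; last exact: adj_sym.
  case: s1 E => [|x1 s1] /= [E1 E2]; subst.
    by move: P; rewrite /= (adj_sym y) exy => /andP[].
  move: P; rewrite -cat_rcons cat_path last_rcons (adj_sym y) exy /=.
  by case/and3P=> -> _ ->.
- move=> z; rewrite -EA E; apply: perm_mem.
  by rewrite perm_cat2l perm_cons perm_rev.
Qed.

Lemma ham_cycle_rev A c : ham_cycle A c -> ham_cycle A (rev c).
Proof.
case=> U C E; split; first by rewrite rev_uniq.
  by apply: etrans C; rewrite rev_cycle; apply: eq_cycle => x y; exact: adj_sym.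
by move=> z; rewrite mem_rev E.
Qed.

(** Opening a Hamilton cycle just after [w] without changing successors. *)
Lemma ham_cycle_ending A c w : ham_cycle A c -> w \in c ->
  exists s, [/\ ham_cycle A (next c w :: s), last (next c w) s = w
    & next (next c w :: s) =1 next c].
Proof.
move=> [U C E] wc; have [n [s Es]] := rot_to_last U wc.
have Ur : uniq (rcons s w) by rewrite -Es rot_uniq.
have nE : next c w = head w (rcons s w).
  rewrite -(next_rot n U) Es -(next_rot (size s) Ur) -cats1 rot_size_cat.
  by case: (s) => [|? ?] /=; rewrite eqxx.
have sE : next c w :: behead (rcons s w) = rot n c by rewrite nE Es; case: (s).
exists (behead (rcons s w)); split.
- by rewrite sE; split; rewrite ?rot_uniq ?rot_cycle // => z; rewrite mem_rot E.
- by rewrite -[LHS]/(last w (next c w :: behead (rcons s w))) sE Es last_rcons.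
- by move=> z; rewrite sE next_rot.
Qed.

(** [crossing] for the Hamilton path that opens the cycle [c] after [w] and ends
with the edge [w v]. On that path the successor of [w] is [v], which is why the
case [b = w] reads differently: there the last hypothesis lets [v] be inserted
between [w] and its successor. *)
Lemma cycle_successor A v c w b : v \in A -> ham_cycle (A :\ v) c ->
  w \in c -> b \in c -> e w v -> e b v ->
  e (next c w) (if b == w then v else next c b) -> hamiltonian A.
Proof.
move=> vA hc wc; have E0 : c =i A :\ v by case: hc.
have [s [[U C E] lastE nE]] := ham_cycle_ending hc wc.
move: U C E lastE nE; move: (next c w) => x U C E lastE nE bc ewv ebv H.
have vs : v \notin x :: s by rewrite E !inE eqxx.
have Us : uniq (x :: rcons s v) by rewrite -rcons_cons rcons_uniq vs.
have bs : b \in x :: s by rewrite E -E0.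
apply: (@crossing A x (rcons s v) b) => //.
- rewrite rcons_path lastE ewv andbT.
  by move: C; rewrite /= rcons_path => /andP[].
- move=> z; rewrite -rcons_cons mem_rcons inE E !inE.
  by case: eqP => // ->.
- by rewrite -rcons_cons mem_rcons inE bs orbT.
- by rewrite last_rcons.
- case: eqP H => [bw|/eqP bw].
    move: Us; rewrite -rcons_cons lastI lastE -bw -!cats1 -catA => Us.
    by rewrite next_consecutive.
  rewrite -nE => H; have [|s1 [s2]] := @next_split _ x _ b U bs.
    by rewrite /= lastE.
  move: (next _ b) H => y H Eb; move: Us; rewrite -rcons_cons Eb rcons_cat => Us.
  by rewrite next_consecutive.
Qed.

(** Reversing the initial segment [x ... q] of a path, made possible by the
relation [r x y] at the new joint. It is used both for adjacency and for the
relation that records how successors change. *)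
Lemma flip_path (r : rel G) x s s1 q y s2 : symmetric r ->
  x :: s = s1 ++ q :: y :: s2 -> path r x s -> r x y ->
  path r q (rev s1 ++ y :: s2) /\ last q (rev s1) = x.
Proof.
move=> r_sym Es; have revE : rev (rcons s1 q) = q :: rev s1 by rewrite rev_rcons.
have [s3 s1E] : exists s3, rcons s1 q = x :: s3.
  by case: s1 Es {revE} => [[-> _]|? s1 [-> _]]; [exists [::] | exists (rcons s1 q)].
have lastE : last q (rev s1) = x.
  by rewrite -[LHS]/(last q (q :: rev s1)) -revE s1E rev_cons last_rcons.
move: Es; rewrite -cat_rcons s1E => -[->].
rewrite cat_path => /andP[P1] /= /andP[_ P2] rxy; split => //.
rewrite cat_path lastE /= rxy P2 !andbT.
rewrite -[path r q _]/(sorted r (q :: rev s1)) -revE s1E rev_sorted.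
by rewrite /= (eq_path (e' := r)) // => a b; exact: r_sym.
Qed.

(** Let [x] be the successor of [w] on the cycle [c], and [y] that of [q]. The edge
[x y] turns the Hamilton path [x ... q y ... w v] into [q ... x y ... w v]. Here
[g] is the successor function of the new path: by [crossing] its values at the
neighbours of [v] are not adjacent to [q], and they are successors or
predecessors on [c] except near the joint and near [v]. *)
Lemma rotation A v c w q : v \in A -> ham_cycle (A :\ v) c -> ~ hamiltonian A ->
    w \in c -> q \in c -> e w v -> e (next c w) (next c q) ->
  exists2 g : G -> G, injective g & forall b, b \in c -> e b v ->
    b != next c w ->
    ~~ e q (g b) /\ g b \in [:: v; next c w; next c b; prev c b].
Proof.
move=> vA hc nham wc qc ewv exy.
have qw : q != w by apply/eqP => qw; rewrite qw adj_irrefl in exy.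
have [Uc Cc E0] := hc.
have [s [[U C E] lastE nE]] := ham_cycle_ending hc wc.
move: U C E lastE nE exy; move: (next c w) => x U C E lastE nE exy.
have [||s1 [s2 Es]] := @next_split _ x (x :: s) q U; rewrite /= ?lastE // ?E -?E0 //.
have vs : v \notin x :: s by rewrite E !inE eqxx.
rewrite -[next c q]nE in exy; move: (next (x :: s) q) exy Es => y exy Es.
have P : path e x s by move: C; rewrite /= rcons_path => /andP[].
have [Pe lastx] := flip_path (@adj_sym G) Es P exy.
have lasty : last y s2 = w.
  by rewrite -lastE -[RHS]/(last x (x :: s)) Es last_cat.
pose p := q :: rcons (rev s1 ++ y :: s2) v.
have pE : perm_eq p (rcons (x :: s) v).
  rewrite /p -rcons_cons -!cats1 perm_cat2r Es -cat_cons -rev_rcons -(cat_rcons q).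
  by rewrite perm_cat2r perm_rev.
have Up : uniq p by rewrite (perm_uniq pE) rcons_uniq vs.
have pA : p =i A.
  move=> z; rewrite (perm_mem pE) mem_rcons inE E !inE.
  by case: eqP => // ->.
exists (next p); first exact: next_inj.
move=> b bc ebv bx; split.
  apply/negP => eqb; apply: nham.
  apply: (@crossing A q (rcons (rev s1 ++ y :: s2) v) b) => //.
  - by rewrite rcons_path Pe last_cat /= lasty.
  - by rewrite pA; move: bc; rewrite E0 !inE => /andP[].
  - by rewrite last_rcons.
(* A symmetric relation containing every step of the new path and its closing
   edge from [v] to [q]. *)
pose r a b := [|| a == x, b == x, a == v, b == v, b == next c a | a == next c b].
have r_sym : symmetric r.
  by move=> a a'; rewrite /r; do !case: (_ == _).
have Pr : path r x s.
  have : fcycle (next c) (x :: s).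
    by rewrite (eq_fcycle (f' := next (x :: s))) ?cycle_next // => ?; rewrite nE.
  rewrite /= rcons_path => /andP[+ _]; apply: sub_path => a a' /= /eqP <-.
  by rewrite /r eqxx !orbT.
have rxy : r x y by rewrite /r eqxx.
have [Qr _] := flip_path r_sym Es Pr rxy.
have Cr : cycle r p.
  rewrite /p /= !rcons_path Qr last_rcons /r !eqxx ?orbT //.
have := next_cycle Cr (_ : b \in p).
rewrite pA; have bA : b \in A by move: bc; rewrite E0 !inE => /andP[].
move=> /(_ bA); rewrite /r (negPf bx) /=.
have -> : b == v = false by apply/eqP => bv; rewrite bv adj_irrefl in ebv.
rewrite /= !inE => /or4P[-> | -> | -> | /eqP bE]; rewrite ?orbT //.
have -> : prev c b = next p b by rewrite {1}bE prev_next.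
by rewrite eqxx !orbT.
Qed.

(** * Missing edges *)

Section Labels.
Context {I : finType} (f : G -> I).
Context (adj_f : forall x y, e x y -> f x != f y).

Definition part A i := [set x in A | f x == i].
Definition nbrs A v := [set w in A | e w v].
Definition miss A x := [set y in A | (f y != f x) && ~~ e x y].
(** Twice the number of missing edges inside [A]. *)
Definition nmiss A := \sum_(x in A) #|miss A x|.

Lemma miss_sym A x y : x \in A -> (y \in miss A x) -> (x \in miss A y).
Proof. by rewrite !inE => -> /andP[_]; rewrite eq_sym adj_sym. Qed.

Lemma card_nbrs A v : v \in A ->
  #|nbrs A v| + #|part A (f v)| + #|miss A v| = #|A|.
Proof.
move=> vA; rewrite -(cardsID (nbrs A v) A) -(cardsID (part A (f v)) (A :\: _)) addnA.
have s1 : A :&: nbrs A v = nbrs A v by apply/setP => x; rewrite !inE andbA andbb.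
have s2 : (A :\: nbrs A v) :&: part A (f v) = part A (f v).
  apply/setP => x; rewrite !inE; case: (x \in A); rewrite //= ?andbF // andbT.
  case: eqP => //= fx; rewrite ?andbF // andbT.
  by apply/negP => /adj_f; rewrite fx eqxx.
have s3 : (A :\: nbrs A v) :\: part A (f v) = miss A v.
  apply/setP => x; rewrite !inE; case: (x \in A); rewrite //= ?andbF // andbT.
  by rewrite adj_sym.
by rewrite s1 s2 s3.
Qed.

Lemma card_missD1 A v x : x \in A -> v \in A -> x != v ->
  #|miss A x| = (x \in miss A v) + #|miss (A :\ v) x|.
Proof.
move=> xA vA xv; rewrite (cardsD1 v) [v \in _]inE [x \in _]inE vA xA adj_sym.
rewrite [f x == _]eq_sym; congr (_ + _).
by apply: eq_card => y; rewrite !inE andbA.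
Qed.

Lemma nmissD1 A v : v \in A -> nmiss A = 2 * #|miss A v| + nmiss (A :\ v).
Proof.
move=> vA; rewrite /nmiss (big_setD1 v) //= mul2n -addnn -addnA; congr (_ + _).
rewrite (eq_bigr (fun x => (x \in miss A v) + #|miss (A :\ v) x|)); last first.
  by move=> x /setD1P[xv xA]; apply: card_missD1.
rewrite big_split /=; congr (_ + _); rewrite -big_mkcondr sum1_card.
apply: eq_card => x; rewrite -topredE /= !inE.
by case: (eqVneq x v) => [->|_]; rewrite ?eqxx ?andbF //= andbA andbb.
Qed.

(** The edge between [x] and [y] is the only one that can be counted twice. *)
Lemma nmiss_pair A x y : x \in A -> y \in A -> x != y ->
  2 * (#|miss A x| + #|miss A y|) <= nmiss A + 2.
Proof.
move=> xA yA xy; rewrite (nmissD1 xA) (@nmissD1 (A :\ x) y); last first.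
  by rewrite !inE eq_sym xy.
rewrite (card_missD1 yA xA); last by rewrite eq_sym.
by case: (_ \in _); lia.
Qed.

Lemma nmiss_ge A x : x \in A -> 2 * #|miss A x| <= nmiss A.
Proof. by move=> xA; rewrite (nmissD1 xA) leq_addr. Qed.

(** * Inserting a vertex into a Hamilton cycle *)

(** The heart of the proof. If no Hamilton cycle of [A] exists, crossings force
all successors and predecessors of the neighbours of [v] on the cycle into the
part of [v]; an edge of the cycle avoiding that part then has an end with too
many missing edges. The second inequality provides such an edge, and the third
says that [v] has more neighbours than missing ones. *)
Lemma insert_vertex A v :
    v \in A -> nmiss A + 2 * #|part A (f v)| + 4 <= 2 * #|A| ->
    2 * #|part A (f v)| <= #|A| -> 2 * #|miss A v| + #|part A (f v)| < #|A| ->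
  hamiltonian (A :\ v) -> hamiltonian A.
Proof.
move=> vA hM hp hm /hamiltonianP[c0 hc0]; apply/contraT => /negP nham.
have dE := card_nbrs vA; move cd : #|nbrs A v| dE => d dE.
have hB : nmiss (A :\ v) + 4 <= 2 * d.
  by move: (nmissD1 vA) hM dE; clear; lia.
have md : #|miss A v| < d by move: hm dE; clear; lia.
have nbrB x : x \in nbrs A v -> x \in A :\ v.
  rewrite !inE => /andP[-> xv]; rewrite andbT.
  by apply: contraTneq xv => ->; rewrite adj_irrefl.
have nbrE x : x \in nbrs A v -> e x v by rewrite inE => /andP[].
have WP c : ham_cycle (A :\ v) c ->
    [/\ #|next c @: nbrs A v| = d, next c @: nbrs A v \subset A :\ v
      & forall y, y \in next c @: nbrs A v -> f y = f v].
  move=> hc; have [U C E] := hc; set W := next c @: _.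
  have cW : #|W| = d by rewrite card_imset //; exact: next_inj.
  have WB : W \subset A :\ v.
    by apply/subsetP => y /imsetP[w wN ->]; rewrite -E mem_next E nbrB.
  have Wv y : y \in W -> ~~ e v y.
    case/imsetP => w wN ->; apply/negP => ev; apply: nham.
    have wc : w \in c by rewrite E nbrB.
    by apply: (cycle_successor vA hc wc wc); rewrite ?nbrE // eqxx adj_sym.
  have WW x y : x \in W -> y \in W -> ~~ e x y.
    case/imsetP => w wN -> /imsetP[b bN ->]; apply/negP => ev; apply: nham.
    have wc : w \in c by rewrite E nbrB.
    have bc : b \in c by rewrite E nbrB.
    apply: (cycle_successor vA hc wc bc); rewrite ?nbrE //.
    by case: eqP ev => // ->; rewrite adj_irrefl.
  (* A successor [y] outside the part of [v]: if some successor [x] lies inside,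
     then [x] misses those outside and [y] those inside, at least [d] in all. *)
  split=> // y yW; apply/eqP; apply: contraT => fy.
  case: (boolP [exists x in W, f x == f v]) => [/existsP[x /andP[xW fx]]|nov].
    have xy : x != y by apply: contraNneq fy => <-.
    have xB := subsetP WB _ xW; have yB := subsetP WB _ yW.
    suff : d <= #|miss (A :\ v) x| + #|miss (A :\ v) y|.
      by move: (nmiss_pair xB yB xy) hB; clear; lia.
    rewrite -cW -(cardsID [set z | f z == f v] W) addnC; apply: leq_add.
      apply/subset_leq_card/subsetP => z; rewrite in_setD in_set => /andP[fz zW].
      by rewrite in_set (subsetP WB) // WW // andbT (eqP fx).
    apply/subset_leq_card/subsetP => z; rewrite in_setI in_set => /andP[zW fz].
    by rewrite in_set (subsetP WB) // WW // andbT (eqP fz) eq_sym.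
  (* All successors lie outside, so that [v] misses every one of them. *)
  suff : #|W| <= #|miss A v| by rewrite cW leqNgt md.
  apply/subset_leq_card/subsetP => x xW; rewrite inE Wv // andbT.
  have := subsetP WB _ xW; rewrite in_setD1 => /andP[_ ->] /=.
  by apply: contraNN nov => fx; apply/existsP; exists x; rewrite xW.
have [U C E] := hc0.
have [cW WB Wf] := WP _ hc0.
have [_ _ Wf'] := WP _ (ham_cycle_rev hc0).
(* The part of [v] has too few vertices left to touch every edge of the cycle. *)
have [q qc /andP[fq fq']] :
    exists2 q, q \in c0 & (f q != f v) && (f (next c0 q) != f v).
  apply/exists_inP; apply: contraT; rewrite negb_exists_in => /forall_inP H.
  pose S := part (A :\ v) (f v).
  have : A :\ v \subset S :|: prev c0 @: S.
    apply/subsetP => q qB; have qc : q \in c0 by rewrite E.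
    have := H q qc; rewrite negb_and !negbK => /orP[fq|fq].
      by rewrite in_setU in_set qB fq.
    rewrite in_setU; apply/orP; right; apply/imsetP; exists (next c0 q).
      by rewrite in_set fq -E mem_next qc.
    by rewrite prev_next.
  move/subset_leq_card/leq_trans => /(_ _ (leq_card_setU _ _)).
  have := leq_imset_card (prev c0) S.
  have : S = part A (f v) :\ v by apply/setP => x; rewrite !inE andbA.
  move=> ->; have := cardsD1 v A; have := cardsD1 v (part A (f v)).
  by rewrite [v \in part _ _]inE vA eqxx; move: hp; clear => /=; lia.
have qB : q \in A :\ v by rewrite -E.
have nqB : next c0 q \in A :\ v by rewrite -E mem_next.
(* The successor of [q] misses all successors of neighbours of [v]: otherwise a
   rotation makes [q] an end of a Hamilton path, and [q] misses as many. *)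
have : next c0 @: nbrs A v \subset miss (A :\ v) (next c0 q).
  apply/subsetP => z zW; rewrite inE (subsetP WB) // (Wf z) // eq_sym fq' /=.
  apply/negP => ez; case/imsetP: zW (zW) => w wN zE zW; rewrite {}zE in ez zW.
  rewrite adj_sym in ez.
  have wc : w \in c0 by rewrite E nbrB.
  have [g g_inj gP] := rotation vA hc0 nham wc qc (nbrE _ wN) ez.
  have : g @: nbrs A v \subset miss A q.
    apply/subsetP => _ /imsetP[b bN ->].
    have bc : b \in c0 by rewrite E nbrB.
    have bw : b != next c0 w.
      apply: contraTneq (nbrE _ bN) => ->; apply/negP => /adj_f.
      by rewrite Wf ?eqxx.
    have [qg gb] := gP b bc (nbrE _ bN) bw.
    have [gA fg] : g b \in A /\ f (g b) = f v.
      have sBA : {subset A :\ v <= A} by apply/subsetP/subsetDl.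
      move: gb; rewrite !inE => /or4P[]/eqP->; first by rewrite vA.
      - by rewrite Wf // sBA // -E mem_next.
      - by rewrite Wf ?imset_f // sBA // -E mem_next.
      - by rewrite sBA -?E ?mem_prev // -next_rev // Wf' ?imset_f.
    by rewrite inE gA fg qg eq_sym fq.
  move/subset_leq_card; rewrite card_imset // cd.
  have qA : q \in A by move: qB; rewrite inE => /andP[].
  have qv : q != v by move: qB; rewrite !inE => /andP[].
  rewrite (card_missD1 qA vA qv) => /leq_trans/(_ (leq_add (leq_b1 _) (leqnn _))).
  by move: (nmiss_ge qB) hB; clear; lia.
move/subset_leq_card; rewrite cW.
by move: (nmiss_ge nqB) hB; clear; lia.
Qed.

(** * Deleting a vertex *)

(** No two labels cover [A], in the form in which a vertex avoiding two given
parts can be picked. *)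
Definition three_parts A := forall i j, exists2 z, z \in A & (f z != i) && (f z != j).

(** The last condition is [m <= p - n_i - 2] doubled, as [nmiss] is [2 m]. *)
Definition admissible A :=
  [/\ three_parts A, forall i, 2 * #|part A i| <= #|A|
    & forall i, nmiss A + 2 * #|part A i| + 4 <= 2 * #|A|].

Lemma part_gt0 A x : x \in A -> 0 < #|part A (f x)|.
Proof. by move=> xA; apply/card_gt0P; exists x; rewrite inE xA eqxx. Qed.

Lemma card_partD1 A v i : v \in A -> #|part A i| = (f v == i) + #|part (A :\ v) i|.
Proof.
move=> vA; rewrite (cardsD1 v) inE vA; congr (_ + _).
by apply: eq_card => y; rewrite !inE andbA.
Qed.

Lemma sub_part A B i : B \subset A -> part B i \subset part A i.
Proof. by move/subsetP=> BA; apply/subsetP => x; rewrite !inE => /andP[/BA -> ->]. Qed.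

Lemma card_part2 A i j : i != j -> #|part A i| + #|part A j| = #|part A i :|: part A j|.
Proof.
move=> ij; rewrite cardsU.
suff -> : part A i :&: part A j = set0 by rewrite cards0 subn0.
apply/setP => x; rewrite !inE; apply/negP => /andP[/andP[_ /eqP fi] /andP[_ /eqP fj]].
by rewrite -fi fj eqxx in ij.
Qed.

Lemma three_partsP A x y z : x \in A -> y \in A -> z \in A ->
  f x != f y -> f z != f x -> f z != f y -> three_parts A.
Proof.
move=> xA yA zA xy zx zy i j.
have [xi|xi] := eqVneq (f x) i; last first.
  have [xj|xj] := eqVneq (f x) j; last by exists x; rewrite ?xi.
  have [yi|yi] := eqVneq (f y) i; last by exists y; rewrite ?yi // -xj eq_sym.
  by exists z; rewrite // -yi -xj zy.
have [yj|yj] := eqVneq (f y) j; last by exists y; rewrite // yj -xi eq_sym xy.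
by exists z; rewrite // -xi -yj zx.
Qed.

Lemma three_partsE A a : a \in A -> three_parts A -> exists x y z,
  [/\ x \in A, y \in A & z \in A] /\ [/\ f x != f y, f z != f x & f z != f y].
Proof.
move=> aA H; have [y yA /andP[ya _]] := H (f a) (f a).
have [z zA /andP[za zy]] := H (f a) (f y).
by exists a, y, z; rewrite eq_sym.
Qed.

Lemma largest_part A (i0 : I) : exists i, forall k, #|part A k| <= #|part A i|.
Proof.
exists [arg max_(i > i0) #|part A i|] => k.
by case: arg_maxnP => // i _; apply.
Qed.

(** If the largest part is unique, remove from it the better of two vertices: all
bounds survive, since [p - a] does not change. Otherwise [p - a] drops by one,
so the removed vertex must lie on a missing edge (if there is one). Then
[2 a + 1 <= p], and the vertex [s] outside two largest parts is spared, lest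
only two parts be left. *)
Lemma delete_vertex A : admissible A -> 4 <= #|A| -> exists2 v, v \in A &
  admissible (A :\ v) /\ 2 * #|miss A v| + #|part A (f v)| < #|A|.
Proof.
case=> H3 Hp HM A4.
have [a0 a0A] : exists x, x \in A by apply/card_gt0P; lia.
have [i max_i] := largest_part A (f a0).
have cA v : v \in A -> #|A| = #|A :\ v|.+1 by move=> vA; rewrite (cardsD1 v) vA.
have le_part v k : #|part (A :\ v) k| <= #|part A k|.
  exact/subset_leq_card/sub_part/subsetDl.
have pair x y : x \in A -> y \in A -> x != y ->
    (2 * #|miss A x| + #|part A i| < #|A|) || (2 * #|miss A y| + #|part A i| < #|A|).
  by move=> xA yA xy; have := nmiss_pair xA yA xy; have := HM i; lia.
have small v : 2 * #|miss A v| + #|part A i| < #|A| ->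
    2 * #|miss A v| + #|part A (f v)| < #|A|.
  by have := max_i (f v); lia.
have [j /andP[ji /eqP pj]|uniq_max] :=
  pickP (fun j => (j != i) && (#|part A j| == #|part A i|)).
  have [s sA /andP[si sj]] := H3 i j.
  have cij : 2 * #|part A i| + 1 <= #|A|.
    have : (part A i :|: part A j) \subset A :\ s.
      apply/subsetP => x; rewrite !inE => /orP[] /andP[-> /eqP fx]; rewrite andbT.
        by apply: contraNneq si => <-; rewrite fx.
      by apply: contraNneq sj => <-; rewrite fx.
    move/subset_leq_card; rewrite -card_part2 1?eq_sym // pj.
    by rewrite (cA _ sA); lia.
  have keep v : v \in A -> v != s -> three_parts (A :\ v).
    move=> vA vs; have [a2|a1] := leqP 2 #|part A i|.
      have rep k : #|part A k| = #|part A i| -> exists2 x, x \in A :\ v & f x = k.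
        move=> pk; have : 0 < #|part (A :\ v) k|.
          by have := card_partD1 k vA; case: (_ == k); lia.
        by case/card_gt0P => x; rewrite inE => /andP[? /eqP]; exists x.
      have [x xA fx] := rep i erefl; have [y yA fy] := rep j pj.
      apply: (@three_partsP _ x y s); rewrite ?fx ?fy //; last by rewrite eq_sym.
      by rewrite !inE eq_sym vs.
    move=> k l; apply/exists_inP; apply: contraT.
    rewrite negb_exists_in => /forall_inP H.
    have : A :\ v \subset part A k :|: part A l.
      apply/subsetP => x xA; have := H x xA; rewrite negb_and !negbK.
      by move: xA; rewrite !inE => /andP[_ ->].
    move/subset_leq_card/leq_trans => /(_ _ (leq_card_setU _ _)).
    by have := max_i k; have := max_i l; have := cA _ vA; lia.
  have good v : v \in A -> v != s -> 2 * #|miss A v| + #|part A i| < #|A| ->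
      (0 < #|miss A v|) || (nmiss A == 0) -> exists2 v, v \in A &
      admissible (A :\ v) /\ 2 * #|miss A v| + #|part A (f v)| < #|A|.
    move=> vA vs mv m0; exists v => //; split; last exact: small.
    have cAv := cA _ vA; have mE := nmissD1 vA.
    split; first exact: keep.
      by move=> k; have := max_i k; have := le_part v k; lia.
    move=> k; have := max_i k; have := le_part v k; have := HM k; have := HM i.
    by case/orP: m0 => [m0|/eqP m0]; lia.
  have [M0|Mgt0] := posnP (nmiss A).
    have [v vP] : exists v, v \in part A i.
      by apply/card_gt0P; have := part_gt0 a0A; have := max_i (f a0); lia.
    move: vP; rewrite inE => /andP[vA /eqP fv].
    apply: (good v); rewrite ?M0 ?orbT //.
      by apply: contraNneq si => <-; rewrite fv.
    by have := nmiss_ge vA; lia.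
  (* Some vertex [y] other than [s] lies on a missing edge. If [y] misses too
     much, it misses at least two vertices, and one of these is not [s]. *)
  have [y [yA ys my]] : exists y, [/\ y \in A, y != s & 0 < #|miss A y|].
    have [x xA] : exists2 x, x \in A & 0 < #|miss A x|.
      apply/exists_inP; apply: contraTT Mgt0; rewrite negb_exists_in => /forall_inP H.
      rewrite -leqNgt leqn0 sum_nat_eq0; apply/forall_inP => x /H.
      by rewrite -leqNgt leqn0.
    case/card_gt0P => z zx; have zA : z \in A by move: zx; rewrite inE => /andP[].
    have [xs|xs] := eqVneq x s; last first.
      by exists x; split => //; apply/card_gt0P; exists z.
    exists z; split => //; last by apply/card_gt0P; exists x; exact: miss_sym.
    by rewrite -xs; apply: contraTneq zx => ->; rewrite !inE eqxx andbF.
  have [ysmall|ybig] := boolP (2 * #|miss A y| + #|part A i| < #|A|).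
    by apply: (good y); rewrite ?my.
  have [z zy zs] : exists2 z, z \in miss A y & z != s.
    have : 0 < #|miss A y :\ s| by have := cardsD1 s (miss A y); case: (s \in _); lia.
    by case/card_gt0P => z; rewrite !inE => /andP[? ?]; exists z; rewrite ?inE.
  have zA : z \in A by move: zy; rewrite inE => /andP[].
  have yz : y != z by apply: contraTneq zy => ->; rewrite !inE eqxx andbF.
  apply: (good z) => //.
    by have := pair _ _ yA zA yz; rewrite (negPf ybig).
  by apply/orP; left; apply/card_gt0P; exists y; apply: miss_sym zy.
have lt_max k : k != i -> #|part A k| < #|part A i|.
  by move=> ki; have := uniq_max k; rewrite ki /= ltn_neqAle max_i andbT => ->.
have [b bA /andP[bi _]] := H3 i i.
have : 1 < #|part A i| by have := lt_max _ bi; have := part_gt0 bA; lia.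
case/card_gt1P => x [y [xP yP xy]].
have [xA /eqP fx] := setIdP xP; have [yA /eqP fy] := setIdP yP.
wlog mx : x y xy {xP yP} xA yA fx fy / 2 * #|miss A x| + #|part A i| < #|A|.
  move=> W; case/orP: (pair _ _ xA yA xy) => m; first exact: (W x y).
  by apply: (W y x); rewrite 1?eq_sym.
exists x => //; split; last exact: small.
have cAx := cA _ xA.
have le_p k : #|part (A :\ x) k| < #|part A i|.
  have := card_partD1 k xA; rewrite fx; have [<-|ik] := eqVneq i k; first lia.
  by have := lt_max k; rewrite eq_sym ik => /(_ isT); lia.
split.
- move=> k l; have [z zA zkl] := H3 k l; have [zx|zx] := eqVneq z x.
    by exists y; [rewrite !inE eq_sym xy | rewrite fy -fx -zx].
  by exists z; rewrite // !inE zx.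
- by move=> k; have := le_p k; have := Hp i; lia.
- move=> k; have := le_p k; have := HM i; have := nmissD1 xA; lia.
Qed.


(** * Chorded cycles in admissible sets *)

Lemma hamiltonian_triangle A : admissible A -> #|A| = 3 -> hamiltonian A.
Proof.
move=> [H3 _ HM] A3.
have [a0 a0A] : exists x, x \in A by apply/card_gt0P; lia.
have [x [y [z [[xA yA zA] [xy zx zy]]]]] := three_partsE a0A H3.
have adjA u w : u \in A -> w \in A -> f u != f w -> e u w.
  move=> uA wA uw; apply: contraT => nuw.
  have : 0 < #|miss A u|.
    by apply/card_gt0P; exists w; rewrite !inE wA eq_sym uw nuw.
  by move: (HM (f u)) (part_gt0 uA) (nmiss_ge uA); rewrite A3; clear; lia.
have U : uniq [:: x; y; z].
  rewrite /= !inE negb_or andbT -andbA; apply/and3P; split.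
  - by apply: contraNneq xy => ->.
  - by apply: contraNneq zx => ->.
  - by apply: contraNneq zy => ->.
apply/hamiltonianP; exists [:: x; y; z]; split=> //.
  by rewrite /= !adjA // eq_sym.
have : [set t in [:: x; y; z]] == A.
  rewrite eqEcard A3 cardsE (card_uniqP U) leqnn andbT.
  by apply/subsetP => t; rewrite !inE => /or3P[]/eqP->.
by move/eqP=> <- t; rewrite in_set.
Qed.

Lemma admissible_hamiltonian A : admissible A -> 2 < #|A| -> hamiltonian A.
Proof.
move: {2}#|A| (leqnn #|A|) => n; elim: n A => [|n IH] A An adA A2; first lia.
have [A4|A3] := leqP 4 #|A|; last by apply: hamiltonian_triangle => //; lia.
have [v vA [adAv mv]] := delete_vertex adA A4.
have cA := cardsD1 v A; rewrite vA in cA.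
have [_ Hp HM] := adA.
by apply: (@insert_vertex A v) => //; apply: IH => //; lia.
Qed.

Lemma admissible_subset A t : admissible A -> 2 < t <= #|A| ->
  exists2 B : {set G}, admissible B & #|B| = t.
Proof.
move=> adA /andP[t2]; move: {2}(#|A| - t) (erefl (#|A| - t)) => n.
elim: n A adA => [|n IH] A adA nE tA; first by exists A => //; lia.
have [v vA [adAv _]] : exists2 v, v \in A &
    admissible (A :\ v) /\ 2 * #|miss A v| + #|part A (f v)| < #|A|.
  by apply: delete_vertex => //; lia.
have cA := cardsD1 v A; rewrite vA in cA.
by apply: IH adAv _ _; lia.
Qed.

(** If all degrees were at most 2, then summing [p <= n_v + m_v + 2] over all
vertices would give [p^2 <= a p + 2 (p - a - 2) + 2 p], that is
[(p - 2)^2 <= a (p - 2)]. With [2 a <= p] this leaves only [p = 4] and [a = 2],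
where the bound [n_v <= a] is strict for some vertex because there are three
parts. *)
Lemma admissible_degree A : admissible A -> 3 < #|A| ->
  exists2 v, v \in A & 2 < #|nbrs A v|.
Proof.
move=> [H3 Hp HM] A4; apply/exists_inP; apply: contraT.
rewrite negb_exists_in => /forall_inP H.
have [a0 a0A] : exists x, x \in A by apply/card_gt0P; lia.
have [i max_i] := largest_part A (f a0).
have deg v : v \in A -> #|A| <= #|part A (f v)| + #|miss A v| + 2.
  by move=> vA; have := H v vA; have := card_nbrs vA; lia.
have {deg} : \sum_(v in A) #|A| <= \sum_(v in A) (#|part A (f v)| + #|miss A v| + 2).
  exact: leq_sum.
rewrite !big_split /= !sum_nat_const -/(nmiss A) => S.
have [b bA /andP[bi _]] := H3 i i.
have [z zA /andP[zi zb]] := H3 i (f b).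
have S1 : \sum_(v in A) #|part A (f v)| <= #|A| * #|part A i|.
  by rewrite -sum_nat_const; apply: leq_sum.
have a2 : (#|A| = 4) * (#|part A i| = 2).
  have := HM i; have := Hp i; move: S S1.
  move: (#|A|) (#|part A i|) (\sum_(v in A) _) (nmiss A) A4 => p a t m p4 *.
  by split; nia.
have [p4 ia] := a2.
have pb : #|part A (f b)| = 1.
  have : part A i :|: part A (f b) \subset A :\ z.
    apply/subsetP => x; rewrite !inE => /orP[] /andP[-> /eqP fx]; rewrite andbT.
      by apply: contraNneq zi => <-; rewrite fx.
    by apply: contraNneq zb => <-; rewrite fx.
  move/subset_leq_card; rewrite -card_part2 1?eq_sym //.
  by have := cardsD1 z A; have := part_gt0 bA; rewrite zA; lia.
have : \sum_(v in A) #|part A (f v)| < #|A| * #|part A i|.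
  rewrite -sum_nat_const (big_setD1 b) //= [X in _ < X](big_setD1 b) //= pb ia.
  rewrite -addSn leq_add //; apply: leq_sum => v _; rewrite -ia; exact: max_i.
have := HM i; nia.
Qed.

(** A vertex of degree at least 3 has a neighbour other than its two neighbours on
the Hamilton cycle. *)
Lemma admissible_chorded_cycle A : admissible A -> 3 < #|A| ->
  has_chorded_cycle G #|A|.
Proof.
move=> adA A4; have [x xA dx] := admissible_degree adA A4.
have /hamiltonianP[c [U C E]] := admissible_hamiltonian adA (ltnW A4).
have sc : size c = #|A| by rewrite -(card_uniqP U) (eq_card E).
exists c; split=> //; first by rewrite /is_cycle /ucycleb C U sc (ltn_trans _ A4).
have [y] : exists y, y \in nbrs A x :\: [set next c x; prev c x].
  apply/card_gt0P; rewrite cardsD subn_gt0; apply: leq_trans dx.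
  rewrite ltnS (leq_trans (subset_leq_card (subsetIr _ _))) // cards2.
  by case: (_ != _).
rewrite !inE negb_or => /andP[/andP[yn yp] /andP[yA yx]].
exists x, y; rewrite /is_chord !E xA yA adj_sym yx yn /=.
by apply: contraNneq yp => ->; rewrite prev_next.
Qed.

End Labels.
End Graph.

(** * Counting edges *)

Lemma sum_degrees (G : sgraph) :
  \sum_(x : G) #|[set y | adj x y]| = 2 * num_edges G.
Proof.
pose P := [set u : G * G | adj u.1 u.2].
have -> : \sum_(x : G) #|[set y | adj x y]| = #|P|.
  rewrite -sum1_card (eq_bigl (fun u : G * G => true && adj u.1 u.2)); last first.
    by move=> u; rewrite inE.
  rewrite -(pair_big_dep xpredT (fun x y => adj x y) (fun _ _ => 1)) /=.
  by apply: eq_bigr => x _; rewrite -sum1_card; apply: eq_bigl => y; rewrite inE.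
pose h (u : G * G) := [set u.1; u.2].
have -> : num_edges G = #|h @: P|.
  apply: eq_card => E.
  by apply/imsetP/imsetP => -[u]; rewrite ?inE => uP ->; exists u; rewrite ?inE.
rewrite -sum1_card (partition_big_imset h) /= mulnC -sum_nat_const.
apply: eq_bigr => _ /imsetP[[x y] /[!inE] /= xy ->]; rewrite sum1dep_card.
have nxy : x != y by apply: contraTneq xy => ->; rewrite adj_irrefl.
suff -> : [set u | (u \in P) && (h u == h (x, y))] = [set (x, y); (y, x)].
  by rewrite cards2 xpair_eqE negb_and nxy.
apply/setP => -[a b]; rewrite !inE /= !xpair_eqE /h /=; apply/andP/orP.
  case=> ab /eqP E; have nab : a != b by apply: contraTneq ab => ->; rewrite adj_irrefl.
  have : a \in [set x; y] by rewrite -E !inE eqxx.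
  have : b \in [set x; y] by rewrite -E !inE eqxx orbT.
  rewrite !inE => /orP[] /eqP bE /orP[] /eqP aE; move: nab; rewrite aE bE ?eqxx //.
    by right.
  by left.
case=> /andP[/eqP-> /eqP->]; first by rewrite xy.
by rewrite adj_sym xy setUC.
Qed.

Lemma sum_parts_complete (k : nat) (n : k.-tuple nat) :
  \sum_(i < k) tnth n i * (\sum_(j < k) tnth n j - tnth n i)
  = 2 * num_edges (complete_multipartite n).
Proof.
rewrite -sum_degrees.
transitivity (\sum_(i < k) \sum_(a < tnth n i) (\sum_(j < k) tnth n j - tnth n i)).
  by apply: eq_bigr => i _; rewrite sum_nat_const card_ord.
rewrite (sig_big_dep _ _ (fun i a => \sum_(j < k) tnth n j - tnth n i)) /=.
apply: eq_bigr => x _; rewrite -sum1dep_card.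
rewrite (bigD1 (tag x)) //= addKn.
transitivity (\sum_(j < k | j != tag x) \sum_(b < tnth n j) 1).
  by apply: eq_bigr => j _; rewrite sum1_card card_ord.
rewrite (sig_big_dep _ _ (fun i a => 1)) /=.
by apply: eq_bigl => y; rewrite andbT eq_sym.
Qed.

Lemma multipartite_labelling (k : nat) (n : k.-tuple nat) (G : sgraph) :
  multipartite_class n G -> exists2 f : G -> 'I_k,
    (forall x y, adj x y -> f x != f y) & forall i, #|part f [set: G] i| = tnth n i.
Proof.
case=> V [VT Vdisj Vcard Vind].
have ex x : exists i, x \in V i.
  have : x \in \bigcup_i V i by rewrite VT inE.
  by case/bigcupP => i _; exists i.
pose f x := xchoose (ex x).
have fP x : x \in V (f x) by exact: xchooseP (ex x).
have fE x i : (f x == i) = (x \in V i).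
  apply/eqP/idP => [<- //|xi]; apply/eqP; apply: contraT => /Vdisj.
  by rewrite disjoint_subset => /subsetP/(_ x (fP x)); rewrite inE /= xi.
exists f => [x y|i].
  by apply: contraTN => /eqP fxy; apply: (Vind (f x)); rewrite // fxy.
by rewrite -Vcard; apply: eq_card => x; rewrite !inE fE.
Qed.

Lemma card_labelled (k : nat) (n : k.-tuple nat) (G : sgraph) (f : G -> 'I_k) :
    (forall i, #|part f [set: G] i| = tnth n i) ->
  #|[set: G]| = \sum_(i < k) tnth n i.
Proof.
move=> pE; rewrite -sum1_card (partition_big f xpredT) //=; apply: eq_bigr => i _.
by rewrite sum1dep_card -pE; apply: eq_card => x; rewrite !inE.
Qed.

(** The degree and the number of missing edges at [x] add up to the degree of a
vertex of the same part in the complete multipartite graph. *)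
Lemma nmiss_edges (k : nat) (n : k.-tuple nat) (G : sgraph) (f : G -> 'I_k) :
    (forall x y, adj x y -> f x != f y) ->
    (forall i, #|part f [set: G] i| = tnth n i) ->
  nmiss f [set: G] + 2 * num_edges G = 2 * num_edges (complete_multipartite n).
Proof.
move=> adj_f pE.
have cG := card_labelled pE.
rewrite -sum_parts_complete -sum_degrees /nmiss.
have -> : \sum_(x : G) #|[set y | adj x y]| = \sum_(x in [set: G]) #|nbrs [set: G] x|.
  apply: eq_big => x; first by rewrite inE.
  by move=> _; apply: eq_card => y; rewrite !inE adj_sym.
rewrite -big_split (partition_big f xpredT) //=; apply: eq_bigr => i _.
transitivity (\sum_(x in [set: G] | f x == i) (\sum_(j < k) tnth n j - tnth n i)).
  apply: eq_bigr => x /andP[xG /eqP fx].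
  by have := card_nbrs adj_f xG; rewrite -cG -pE -fx; clear; lia.
rewrite sum_nat_cond_const -pE; congr (_ * _).
Qed.

Import GRing.Theory Num.Theory.
Local Open Scope ring_scope.

Theorem theorem24 (k : nat) (n : k.-tuple nat) :
  let n1 : rat := (head 0%N n)%:R in
  let p : rat := (\sum_(i < k) tnth n i)%N%:R in
  let bound : rat := (num_edges (complete_multipartite n))%:R - (p - n1 - 2) in
  (3 <= k)%N ->
  (forall i : 'I_k, (0 < tnth n i)%N) ->
  (forall i j : 'I_k, (i <= j)%N -> (tnth n j <= tnth n i)%N) ->
  n1 <= p / 2 ->
  bound = (4 - 2 * p + 2 * n1
           + \sum_(i < k) (tnth n i)%:R * (p - (tnth n i)%:R)) / 2
  /\ forall G : sgraph, multipartite_class n G ->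
       bound <= (num_edges G)%:R -> chorded_pancyclic G.

Proof.
move=> n1 p bound k3 n_gt0 n_dec n1p.
have n1E : head 0%N n = tnth n (Ordinal (ltnW (ltnW k3))).
  by rewrite (tnth_nth 0%N) nth0.
have n1_max i : (tnth n i <= head 0%N n)%N by rewrite n1E n_dec.
have le_p i : (tnth n i <= \sum_(j < k) tnth n j)%N by rewrite (bigD1 i) //= leq_addr.
have {}n1p : (2 * head 0%N n <= \sum_(j < k) tnth n j)%N.
  move: n1p; rewrite /n1 /p ler_pdivlMr // -natrM ler_nat mulnC //.
split.
  rewrite /bound; set q := num_edges _.
  have -> : \sum_(i < k) (tnth n i)%:R * (p - (tnth n i)%:R) = 2 * q%:R :> rat.
    rewrite -natrM -sum_parts_complete natr_sum; apply: eq_bigr => i _.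
    by rewrite natrM natrB.
  by field.
move=> G /multipartite_labelling[f adj_f pE] boundG.
have nE := nmiss_edges adj_f pE.
have cG := card_labelled pE.
have M : (nmiss f [set: G] + 2 * head 0 n + 4 <= 2 * #|[set: G]|)%N.
  have : (num_edges (complete_multipartite n) + head 0 n + 2
          <= num_edges G + #|[set: G]|)%N.
    by rewrite -(ler_nat rat) cG !natrD; move: boundG; rewrite /bound /n1 /p; lra.
  by move: nE; clear; lia.
have vertex_of i : exists2 x, x \in [set: G] & f x = i.
  have : (0 < #|part f [set: G] i|)%N by rewrite pE.
  by case/card_gt0P => x /setIdP[xG /eqP fx]; exists x.
have adG : admissible f [set: G].
  split.
  - have [x xG fx] := vertex_of (Ordinal (ltnW (ltnW k3))).
    have [y yG fy] := vertex_of (Ordinal (ltnW k3)).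
    have [z zG fz] := vertex_of (Ordinal k3).
    by apply: (three_partsP xG yG zG); rewrite ?fx ?fy ?fz.
  - by move=> i; rewrite pE cG; move: (n1_max i) n1p; clear; lia.
  - by move=> i; rewrite pE; move: (n1_max i) M; clear; lia.
move=> t /andP[t4 tG].
have [|B adB cB] := admissible_subset adG (t := t).
  by rewrite cardsT tG ltnW.
by rewrite -cB; apply: (admissible_chorded_cycle adj_f adB); rewrite cB.
Qed.
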